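(* Let $0<\eta<1$, let $\mathcal D$ be a general dyadic grid in $\mathbb{R}^n$, and let $\mathcal S\subset\mathcal D$ be an $\eta$-sparse family of cubes with associated sparse operator $\mathcal A_{\mathcal S}$. Then there is a constant $C>0$ such that, for every $t>0$ and every measurable function $f$, $$(\mathcal A_{\mathcal S}f)^*(t)\le C\left(\frac1t\int_0^t f^*(s)\,ds+\int_t^\infty f^*(s)\,\frac{ds}{s}\right).$$
   Context: A general dyadic grid $\mathcal D$ is a collection of cubes in $\mathbb{R}^n$ such that: (i) every $Q\in\mathcal D$ has side length $2^k$ for some $k\in\mathbb{Z}$; (ii) every two cubes in $\mathcal D$ are either disjoint or one is wholly contained in the other; (iii) for every $k\in\mathbb{Z}$ and $x\in\mathbb{R}^n$ there is only one cube in $\mathcal D$ of side length $2^k$ containing $x$. A collection $\mathcal S\subset\mathcal D$ is $\eta$-sparse if one can choose pairwise disjoint measurable sets $E_Q\subset Q$, $Q\in\mathcal S$, with $|E_Q|\ge\eta|Q|$. The sparse operator is $\mathcal A_{\mathcal S}f(x)=\sum_{Q\in\mathcal S}\left(\frac1{|Q|}\int_Q f(y)\,dy\right)\chi_Q(x)$, $x\in\mathbb{R}^n$. The decreasing rearrangement with respect to Lebesgue measure is $f^*(t)=\inf\{s>0:|\{|f|>s\}|\le t\}$. *)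

(* Defs.v *)
From HB Require Import structures.
From mathcomp Require Import all_boot all_order all_algebra.
From mathcomp Require Import all_classical all_reals all_analysis.
From mathcomp Require Import measurable_realfun.

Set Implicit Arguments.
Unset Strict Implicit.
Unset Printing Implicit Defensive.
Import Order.TTheory GRing.Theory Num.Theory.
Import numFieldNormedType.Exports.

Local Open Scope classical_set_scope.
Local Open Scope ring_scope.

Section tuple_cons.
Context {R : realType} (n : nat).
Local Notation TR := (measurableTypeR R).

Definition tcons (p : TR * n.-tuple TR) : n.+1.-tuple TR :=
  [tuple of p.1 :: p.2].

Definition tuncons (x : n.+1.-tuple TR) : TR * n.-tuple TR :=
  (thead x, [tuple of behead x]).

Lemma tconsK : cancel tcons tuncons.
Proof. by case=> a b; congr pair; apply/val_inj. Qed.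

Lemma tunconsK : cancel tuncons tcons.
Proof. by move=> x; rewrite /tcons [RHS]tuple_eta; apply/val_inj. Qed.

Lemma measurable_tcons : measurable_fun setT tcons.
Proof. exact: (measurable_cons measurable_fst measurable_snd). Qed.

Lemma measurable_tuncons : measurable_fun setT tuncons.
Proof.
by apply/measurable_fun_pairP; split;
  [exact: measurable_tnth|exact: measurable_behead].
Qed.

End tuple_cons.

Section product_step.
Context {R : realType} (n : nat).
Local Notation TR := (measurableTypeR R).
Variable m : {sigma_finite_measure set (n.-tuple TR) -> \bar R}.

Definition lebesgue_product : set (n.+1.-tuple TR) -> \bar R :=
  pushforward (lebesgue_measure \x m)%E (@tcons R n).

Let p : {measure set (n.+1.-tuple TR) -> \bar R} :=
  measure_function_pushforward__canonical__measure_function_Measure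
    (lebesgue_measure \x m)%E (@measurable_tcons R n).

HB.instance Definition _ := isMeasure.Build _ _ _ lebesgue_product
  (measure0 p) (measure_ge0 p) (@measure_semi_sigma_additive _ _ _ p).

Let sigma_finite_lebesgue_product : sigma_finite setT lebesgue_product.
Proof.
have /sigma_finiteP[F [TF ndF Foo]] := sigma_finiteT (@lebesgue_measure R).
have /sigma_finiteP[G [TG ndG Goo]] := sigma_finiteT m.
exists (fun k => @tuncons R n @^-1` (F k `*` G k)).
  rewrite -preimage_bigcup (_ : \bigcup_k _ = setT) ?preimage_setT//.
  rewrite -subTset => -[x y] _ /=.
  have [i _ Fx] : (\bigcup_k F k) x by rewrite -TF.
  have [j _ Gy] : (\bigcup_k G k) y by rewrite -TG.
  exists (maxn i j) => //; split => /=.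
    by move: x Fx; exact/subsetPset/ndF/leq_maxl.
  by move: y Gy; exact/subsetPset/ndG/leq_maxr.
move=> k; have [mF Fk] := Foo k; have [mG Gk] := Goo k; split.
  by rewrite -[X in measurable X]setTI;
    apply: measurable_tuncons => //; exact: measurableX.
rewrite /lebesgue_product /pushforward -comp_preimage (_ : _ \o _ = id).
  by rewrite preimage_id product_measure1E// lte_mul_pinfty// ge0_fin_numE.
by apply/funext => z /=; rewrite tconsK.
Qed.

HB.instance Definition _ := Measure_isSigmaFinite.Build _ _ _ lebesgue_product
  sigma_finite_lebesgue_product.

End product_step.

Fixpoint borel_lebesgue (R : realType) (n : nat) :
    {sigma_finite_measure set (n.-tuple (measurableTypeR R)) -> \bar R} :=
  match n with
  | 0 => dirac ([tuple] : 0.-tuple (measurableTypeR R))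
  | m.+1 => lebesgue_product (borel_lebesgue R m)
  end.

(* R^n with the Lebesgue sigma-algebra: the Caratheodory completion of the
   Borel sets. *)
Definition Rn (R : realType) (n : nat) :=
  caratheodory_type (borel_lebesgue R n)^*%mu.
HB.instance Definition _ (R : realType) (n : nat) := Measurable.on (Rn R n).

Definition coord (R : realType) (n : nat) (x : Rn R n) (i : 'I_n) : R :=
  tnth (x : n.-tuple (measurableTypeR R)) i.

Definition lebesgue_Rn (R : realType) (n : nat) : set (Rn R n) -> \bar R :=
  @completed_measure_extension _ _ R (borel_lebesgue R n).
HB.instance Definition _ (R : realType) (n : nat) :=
  Measure.on (@lebesgue_Rn R n).

Lemma lebesgue_Rn_sigma_finite (R : realType) (n : nat) :
  sigma_finite setT (@lebesgue_Rn R n).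
Proof. exact/completed_measure_extension_sigma_finite/sigma_finiteT. Qed.

HB.instance Definition _ (R : realType) (n : nat) :=
  Measure_isSigmaFinite.Build _ _ _ (@lebesgue_Rn R n)
    (@lebesgue_Rn_sigma_finite R n).

Lemma measurable_box (R : realType) (n : nat)
    (I : 'I_n -> set (measurableTypeR R)) : (forall i, measurable (I i)) ->
  measurable [set x : n.-tuple (measurableTypeR R) | forall i, I i (tnth x i)].
Proof.
move=> mI; rewrite (_ : mkset _ =
    \bigcap_(i in [set: 'I_n]) [set x | I i (tnth x i)]).
  apply: fin_bigcap_measurable => // i _.
  by rewrite -[X in measurable X]setTI; exact: measurable_tnth.
by apply/seteqP; split=> [x h i _|x h i]; [exact: (h i)|exact: (h i Logic.I)].
Qed.

Lemma borel_lebesgue_box (R : realType) (n : nat)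
    (I : 'I_n -> set (measurableTypeR R)) : (forall i, measurable (I i)) ->
  borel_lebesgue R n [set x | forall i, I i (tnth x i)] =
  (\prod_(i < n) lebesgue_measure (I i))%E.
Proof.
elim: n I => [|n IH] I mI /=.
  by rewrite big_ord0 diracE mem_set// => -[].
rewrite /lebesgue_product /pushforward (_ : _ @^-1` _ =
  I ord0 `*` [set x | forall i, I (lift ord0 i) (tnth x i)]).
  rewrite product_measure1E ?big_ord_recl//.
    by rewrite -(IH (I \o lift ord0))// => i; exact: mI.
  by apply: (@measurable_box R n (I \o lift ord0)) => i; exact: mI.
apply/seteqP; split=> [[a x] /= h|[a x] /= [h0 h] i].
  split; first exact: (h ord0).
  by move=> i; have := h (lift ord0 i); rewrite /tcons tnthS.
by case: (unliftP ord0 i) => [j ->|->//]; rewrite /tcons tnthS; exact: h.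
Qed.

Lemma lebesgue_Rn_box (R : realType) (n : nat)
    (I : 'I_n -> set (measurableTypeR R)) : (forall i, measurable (I i)) ->
  lebesgue_Rn [set x : Rn R n | forall i, I i (coord x i)] =
  (\prod_(i < n) lebesgue_measure (I i))%E.
Proof.
move=> mI; rewrite -borel_lebesgue_box//.
by apply: measurable_mu_extE; exact: (measurable_box mI).
Qed.

Section dyadic.
Context {R : realType} {n : nat}.
Implicit Types (Q : set (Rn R n)) (D S : set (set (Rn R n))).

(* Cubes have edges parallel to the axes and side length h > 0; which faces
   belong to the cube is left free, so that half-open cubes are covered. *)
Definition is_cube (h : R) Q : Prop :=
  0 < h /\ exists (a : 'I_n -> R) (l r : 'I_n -> bool),
    Q = [set x | forall i,
           coord x i \in Interval (BSide (l i) (a i)) (BSide (r i) (a i + h))].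

Definition dyadic_grid D : Prop :=
  [/\ forall Q, D Q -> exists k : int, is_cube (2 ^ k) Q,
      forall Q Q', D Q -> D Q' -> [\/ Q `&` Q' = set0, Q `<=` Q' | Q' `<=` Q]
    & forall (k : int) (x : Rn R n),
        exists! Q, [/\ D Q, is_cube (2 ^ k) Q & Q x]].

Definition sparse (eta : R) S : Prop :=
  exists E : set (Rn R n) -> set (Rn R n),
    [/\ forall Q, S Q -> measurable (E Q),
        forall Q, S Q -> E Q `<=` Q,
        forall Q, S Q -> (eta%:E * lebesgue_Rn Q <= lebesgue_Rn (E Q))%E
      & trivIset S E].

Definition average Q (f : Rn R n -> \bar R) : \bar R :=
  ((fine (lebesgue_Rn Q))^-1%:E * \int[@lebesgue_Rn R n]_(y in Q) f y)%E.

End dyadic.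

(* Unconditional sum of a family of arbitrary sign; \esum alone is the sum only
   for nonnegative terms. *)
Definition signed_esum (R : realType) (T : choiceType) (I : set T)
    (a : T -> \bar R) : \bar R :=
  (\esum_(i in I) a^\+ i - \esum_(i in I) a^\- i)%E.

Definition sparse_operator (R : realType) (n : nat) (S : set (set (Rn R n)))
    (f : Rn R n -> \bar R) (x : Rn R n) : \bar R :=
  signed_esum S (fun Q => average Q f * (\1_Q x)%:E)%E.

Definition rearrangement d (T : measurableType d) (R : realType)
    (mu : set T -> \bar R) (f : T -> \bar R) (t : R) : \bar R :=
  ereal_inf [set s%:E | s in
    [set s : R | 0 < s /\ (mu [set x | s%:E < `|f x|] <= t%:E)%E]].

(* Main.v *)
Require Import Defs.
From mathcomp Require Import all_boot all_order all_algebra.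
From mathcomp Require Import all_classical all_reals all_analysis.
From mathcomp Require Import measurable_realfun.
From mathcomp Require Import ring lra.

(** Write f^* for the rearrangement and a_Q for the average of |f| over Q, and
    let B bound the right-hand side (without the constant). With c_i = f^*(2^i t)
    there are h_i > 0 such that the integral of (|f| - c_i)_+ is at most
    2^i (t/2) h_i and the sum of lam_i = c_i + h_i is at most 11 B; by the weak
    (1,1) bound for nested families, the cubes with a_Q > lam_i cover a set of
    measure at most 2^i (t/2). It suffices to treat finite subfamilies of S. If
    the sparse sum exceeds s on a set of measure > t, remove the cubes with
    a_Q > lam_0 to get a set F with |F| > t/2, on which only cubes with
    a_Q <= lam_0 matter. With b_Q = |F n Q| / |Q|, duality and sparsity give
    s |F| <= sum a_Q |F n Q| <= eta^-1 sum a_Q b_Q |E_Q|.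
    Let P_i be the set of cubes with a_Q > lam_i or b_Q > 2^-i. The E_Q, Q in P_i,
    have total measure at most 2^i (t/2 + |F|), and a cube outside P_i has
    a_Q b_Q <= lam_i 2^-i. Grouping the cubes by the first i with Q in P_(i+1),
    the last sum is at most 4 |F| times the sum of the lam_i, whence
    s <= 44 B / eta. *)

Set Implicit Arguments.
Unset Strict Implicit.
Unset Printing Implicit Defensive.

Import Order.TTheory GRing.Theory Num.Theory.
Import numFieldNormedType.Exports.

Local Open Scope classical_set_scope.
Local Open Scope ring_scope.

(** * Layer cake formula and measurability of monotone functions *)

(** Tonelli on the region [A] under the graph of [u]: its section at [x] has length [u x], and its
    section at height [a] is a superlevel set. *)
Lemma layer_cake d (T : measurableType d) (R : realType)
    (mu : {sigma_finite_measure set T -> \bar R}) (u : T -> \bar R) :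
  measurable_fun setT u -> (forall x, 0 <= u x)%E ->
  (\int[mu]_x u x =
   \int[@lebesgue_measure R]_(a in `[0%R, +oo[) mu [set x | a%:E < u x])%E.
Proof.
move=> mu_u u0.
pose A := [set p : T * measurableTypeR R | (0 <= p.2)%R /\ (p.2%:E < u p.1)%E].
have mA : measurable A.
  rewrite (_ : A = [set p | (0 <= p.2)%R] `&` [set p | (p.2%:E < u p.1)%E])//.
  apply: measurableI.
    rewrite -[X in measurable X]setTI; apply: measurable_fun_ler => //.
  rewrite -[X in measurable X]setTI; apply: emeasurable_fun_lt => //.
    by apply/measurable_EFinP; exact: measurable_snd.
  exact: (measurableT_comp mu_u measurable_fst).
transitivity (\int[mu]_x \int[@lebesgue_measure R]_a (\1_A (x, a))%:E)%E.
  apply: eq_integral => x _.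
  transitivity (\int[@lebesgue_measure R]_a
      (\1_[set a : R | (0 <= a)%R /\ (a%:E < u x)%E] a)%:E)%E; last first.
    by apply: eq_integral.
  rewrite integral_indic// ?setIT; last first.
    have mS : measurable ([set a | 0 <= a] `&` [set a | (a%:E < u x)%E] :
        set (measurableTypeR R)).
      apply: measurableI; rewrite -[X in measurable X]setTI.
        exact: measurable_fun_ler.
      by apply: measurable_lte => //; apply/measurable_EFinP;
        exact: measurable_id.
    exact: mS.
  case: (u x) (u0 x) => [r r0||]//.
  - rewrite [RHS](_ : _ = lebesgue_measure `[0%R, r[%classic).
      rewrite lebesgue_measure_itv/=.
      rewrite lee_fin in r0; rewrite lte_fin oppr0 -EFinD addr0.
      by case: (ltgtP 0 r) r0 => // <-.
    congr (lebesgue_measure _); apply/seteqP; split=> a /=;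
      rewrite in_itv/= lte_fin.
      by case=> -> ->.
    by move/andP.
  - move=> _; rewrite [RHS](_ : _ = lebesgue_measure `[0%R, +oo[%classic).
      by rewrite lebesgue_measure_itv/= ltry.
    congr (lebesgue_measure _); apply/seteqP; split=> a /=;
      rewrite in_itv/= andbT ltry.
      by case.
    by [].
rewrite (fubini_tonelli (fun p : T * measurableTypeR R => (\1_A p)%:E))//=;
  last first.
  by apply/measurable_EFinP/measurable_indic.
rewrite [RHS]integral_mkcond/=; apply: eq_integral => a _.
rewrite patchE/=; case: ifPn; rewrite ?inE ?notin_setE/= in_itv/= andbT => a0.
  transitivity (\int[mu]_x (\1_[set x | (a%:E < u x)%E] x)%:E)%E.
    apply: eq_integral => x _; rewrite !indicE; congr (_%:R%:E);
      congr nat_of_bool.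
    by apply/idP/idP; rewrite !inE/= => -[].
  by rewrite integral_indic ?setIT// -[X in measurable X]setTI;
    exact: emeasurable_fun_o_infty.
by apply: integral0_eq => x _; rewrite indicE memNset//= => -[] /= /a0.
Qed.

Lemma nonincreasing_emeasurable (R : realType)
    (h : measurableTypeR R -> \bar R) :
  (forall a b : R, a <= b -> (h b <= h a)%E) -> measurable_fun setT h.
Proof.
move=> hni; apply: (measurability (@ErealGenOInfty.G R)) => [|/= _ [_] [r] -> <-].
  exact: ErealGenOInfty.measurableE.
rewrite setTI; apply: is_interval_measurable => s t/=.
rewrite !in_itv/= !andbT => _ ft u /andP[_ ut].
by rewrite in_itv/= andbT (lt_le_trans ft)// hni.
Qed.

(** * The decreasing rearrangement and truncation above a level *)

Section rearrangement.
Context d (T : measurableType d) (R : realType).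
Variables (mu : {measure set T -> \bar R}) (f : T -> \bar R).
Hypothesis mf : measurable_fun setT f.
Implicit Types s t a c : R.

Lemma rearrangement_ge0 s : (0 <= rearrangement mu f s)%E.
Proof. by apply: le_ereal_inf_tmp => _ [a [a0 _] <-]; rewrite lee_fin ltW. Qed.

Lemma le_rearrangement s t : s <= t ->
  (rearrangement mu f t <= rearrangement mu f s)%E.
Proof.
move=> st; apply: ereal_inf_le_tmp => _ [a [a0 ha] <-].
by exists a => //; split=> //; rewrite (le_trans ha)// lee_fin.
Qed.

Lemma measurable_superlevel a : measurable [set x | (a%:E < `|f x|)%E].
Proof.
rewrite -[X in measurable X]setTI; apply: emeasurable_fun_o_infty => //.
exact: measurableT_comp.
Qed.

(** Each level [c + 1/(k+1)] lies strictly above the infimum, hence above an admissible level, so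
    [F k] has measure at most [s]. The [F k] increase to the superlevel set at [c], and continuity
    from below concludes. *)
Lemma measure_superlevel_rearrangement s c :
  (rearrangement mu f s <= c%:E)%E ->
  (mu [set x | (c%:E < `|f x|)%E] <= s%:E)%E.
Proof.
move=> hc.
pose F (k : nat) := [set x | ((c + k.+1%:R^-1)%:E < `|f x|)%E].
have mF k : measurable (F k) by exact: measurable_superlevel.
have -> : [set x | (c%:E < `|f x|)%E] = \bigcup_k F k.
  apply/seteqP; split=> [x /= cx|x [k _] /=]; last first.
    by apply: le_lt_trans; rewrite lee_fin lerDl invr_ge0 ler0n.
  have [e e0 ce] : exists2 e : R, 0 < e & ((c + e)%:E <= `|f x|)%E.
    case: (`|f x|)%E cx => [r cr|_|]//; last by exists 1; rewrite ?leey.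
    exists (r - c); first by rewrite subr_gt0 -lte_fin.
    by rewrite lee_fin subrKC.
  have [k ke] : exists k : nat, k.+1%:R^-1 < e.
    exists (Num.truncn e^-1).
    by rewrite -[ltRHS]invrK ltf_pV2 ?posrE ?invr_gt0// truncnS_gt.
  exists k => //=; apply: lt_le_trans ce.
  by rewrite lte_fin ltrD2l.
have cF : mu (F k) @[k --> \oo] --> mu (\bigcup_k F k).
  apply: nondecreasing_cvg_mu => //; first exact: bigcup_measurable.
  apply/nondecreasing_seqP => k; apply/subsetPset => x /=.
  by apply: le_lt_trans; rewrite lee_fin lerD2l lef_pV2 ?posrE// ler_nat.
rewrite -(cvg_lim _ cF)//; apply: lime_le.
  by apply/cvg_ex; exists (mu (\bigcup_k F k)).
apply: nearW => k.
have : (rearrangement mu f s < (c + k.+1%:R^-1)%:E)%E.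
  by rewrite (le_lt_trans hc)// lte_fin ltrDl invr_gt0.
move=> /ereal_inf_lt[_ [a [a0 ha] <-]] ak.
apply: le_trans ha; apply: le_measure; rewrite ?inE//;
  first exact: measurable_superlevel.
by move=> x /=; apply: le_lt_trans; exact: ltW.
Qed.

Lemma lt_rearrangement s a : (s%:E < mu [set x | (a%:E < `|f x|)%E])%E ->
  (a%:E < rearrangement mu f s)%E.
Proof.
by apply: contraTT; rewrite -!leNgt; exact: measure_superlevel_rearrangement.
Qed.

Lemma measurable_rearrangement (D : set (measurableTypeR R)) :
  measurable_fun D (rearrangement mu f).
Proof.
apply: (@measurable_funS _ _ _ _ setT) => //.
by apply: nonincreasing_emeasurable => a b; exact: le_rearrangement.
Qed.

Definition excess c x : \bar R := maxe (`|f x| - c%:E)%E 0%E.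

Lemma excess_ge0 c x : (0 <= excess c x)%E.
Proof. by rewrite /excess le_max lexx orbT. Qed.

Lemma measurable_excess c D : measurable_fun D (excess c).
Proof.
apply: (@measurable_funS _ _ _ _ setT) => //.
apply: measurable_maxe => //; apply: emeasurable_funB => //.
exact: measurableT_comp.
Qed.

Lemma lt_excess a c x : 0 <= a ->
  (a%:E < excess c x)%E = ((a + c)%:E < `|f x|)%E.
Proof.
move=> a0; rewrite /excess lt_max [X in _ || X]ltNge lee_fin a0 orbF.
by rewrite lteBrDr.
Qed.

End rearrangement.

(** Both sides are expanded by [layer_cake] and compared height by height. With [m] the measure of
    the set where [|f| > a + c], one has [m <= t], and every [s] in []0, m[] satisfies [f^*(s) > a].
    So the superlevel set on the right contains an interval of length [m]. *)
Lemma integral_excess_le d (T : measurableType d) (R : realType)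
    (mu : {sigma_finite_measure set T -> \bar R}) (f : T -> \bar R)
    (mf : measurable_fun setT f) (t c : R) :
  0 <= c -> (rearrangement mu f t <= c%:E)%E ->
  (\int[mu]_x excess f c x <=
   \int[@lebesgue_measure R]_(s in `]0%R, t]) rearrangement mu f s)%E.
Proof.
move=> c0 tc; rewrite layer_cake; [|exact: measurable_excess|exact: excess_ge0].
have mr : measurable_fun setT
    (rearrangement mu f \_ `]0%R, t] : measurableTypeR R -> \bar R).
  by apply/(measurable_restrictT _ _).1 => //; exact: measurable_rearrangement.
rewrite [leRHS]integral_mkcond [leRHS]layer_cake//; last first.
  by move=> s; apply: erestrict_ge0 => ? _; exact: rearrangement_ge0.
apply: ge0_le_integral => //.
- apply: (@measurable_funS _ _ _ _ setT) => //;
    apply: nonincreasing_emeasurable.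
  move=> a b ab; apply: le_measure; rewrite ?inE//.
  + by rewrite -[X in measurable X]setTI; apply: emeasurable_fun_o_infty => //;
      exact: measurable_excess.
  + by rewrite -[X in measurable X]setTI; apply: emeasurable_fun_o_infty => //;
      exact: measurable_excess.
  + by move=> x /=; apply: le_lt_trans; rewrite lee_fin.
- apply: (@measurable_funS _ _ _ _ setT) => //;
    apply: nonincreasing_emeasurable.
  move=> a b ab; apply: le_measure; rewrite ?inE//.
  + by rewrite -[X in measurable X]setTI; apply: emeasurable_fun_o_infty => //.
  + by rewrite -[X in measurable X]setTI; apply: emeasurable_fun_o_infty => //.
  + by move=> x /=; apply: le_lt_trans; rewrite lee_fin.
move=> a /=; rewrite in_itv/= andbT => a0.
rewrite (_ : mkset _ = [set x | ((a + c)%:E < `|f x|)%E]); last first.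
  by apply/seteqP; split=> x /=; rewrite lt_excess.
set m := mu _.
have mt : (m <= t%:E)%E.
  apply: le_trans (measure_superlevel_rearrangement mf tc).
  apply: le_measure; rewrite ?inE; try exact: measurable_superlevel.
  by move=> x /=; apply: le_lt_trans; rewrite lee_fin lerDr.
have mfin : m \is a fin_num.
  by rewrite ge0_fin_numE ?measure_ge0// (le_lt_trans mt)// ltry.
have m0 : 0 <= fine m by rewrite fine_ge0// measure_ge0.
have -> : m = lebesgue_measure (`]0%R, fine m[%classic : set R).
  rewrite lebesgue_measure_itv/= lte_fin oppr0 addr0 fineK//.
  by case: (ltgtP 0 (fine m)) m0 => // m0E _; rewrite -[LHS]fineK// -m0E.
apply: le_measure; rewrite ?inE//.
  by rewrite -[X in measurable X]setTI; apply: emeasurable_fun_o_infty.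
move=> s /=; rewrite in_itv/= => /andP[s0 sm].
have smE : (s%:E < m)%E by rewrite -[m]fineK// lte_fin.
rewrite patchE mem_set; last first.
  by rewrite /= in_itv/= s0 -lee_fin ltW// (lt_le_trans smE).
apply: (lt_rearrangement mf); apply: (lt_le_trans smE).
apply: le_measure; rewrite ?inE; try exact: measurable_superlevel.
by move=> x /=; apply: le_lt_trans; rewrite lee_fin lerDl.
Qed.

Lemma integral_cst_itv (R : realType) (b c : bool) (x y : R) (k : \bar R) :
  x <= y ->
  (\int[@lebesgue_measure R]_(_ in [set` Interval (BSide b x) (BSide c y)]) k =
   k * (y - x)%:E)%E.
Proof.
move=> xy; rewrite integral_cst//; congr (_ * _)%E.
rewrite [LHS](_ : _ = lebesgue_measure [set` Interval (BSide b x) (BSide c y)])//.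
rewrite lebesgue_measure_itv/= lte_fin -EFinD.
by case: ltgtP xy => // -> _; rewrite subrr.
Qed.

(** Lowering the level from [c] to [c'] raises the excess by at most [c - c'], and only on the set
    where [|f| > c'], which has measure at most [s]. *)
Lemma integral_excess_step d (T : measurableType d) (R : realType)
    (mu : {measure set T -> \bar R}) (f : T -> \bar R)
    (mf : measurable_fun setT f) (s c c' : R) :
  0 <= c' -> c' <= c -> (rearrangement mu f s <= c'%:E)%E ->
  (\int[mu]_x excess f c' x <= \int[mu]_x excess f c x + ((c - c') * s)%:E)%E.
Proof.
move=> c'0 c'c sc'.
pose A := [set x | (c'%:E < `|f x|)%E].
have mA : measurable A by exact: measurable_superlevel.
have mE : measurable_fun setT (fun x => ((c - c') * \1_A x)%:E).
  by apply/measurable_EFinP; apply: measurable_funM => //;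
    exact: measurable_indic.
have E0 x : (0 <= ((c - c') * \1_A x)%:E)%E.
  by rewrite lee_fin mulr_ge0// subr_ge0.
apply: (@le_trans _ _ (\int[mu]_x (excess f c x + ((c - c') * \1_A x)%:E)))%E.
  apply: ge0_le_integral => //.
  - by move=> x _; exact: excess_ge0.
  - exact: measurable_excess.
  - by apply: emeasurable_funD => //; exact: measurable_excess.
  move=> x _; rewrite /excess indicE.
  have [cx|] := boolP (x \in A); last first.
    rewrite notin_setE => /negP; rewrite -leNgt => cx.
    rewrite mulr0 adde0 max_r; last by rewrite leeBlDr// add0e.
    by rewrite le_max lexx orbT.
  rewrite mulr1 adde_maxl.
  rewrite ge_max; apply/andP; split; rewrite le_max; apply/orP; [left|right].
    rewrite -addeA -EFinN -EFinD leeD2l// lee_fin; lra.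
  by rewrite add0e lee_fin subr_ge0.
rewrite ge0_integralD//; last 2 first.
- by move=> x _; exact: excess_ge0.
- exact: measurable_excess.
rewrite leeD2l//.
under eq_integral do rewrite EFinM.
rewrite ge0_integralZl_EFin ?subr_ge0//; last first.
  by apply/measurable_EFinP; exact: measurable_indic.
rewrite integral_indic// setIT EFinM lee_wpmul2l ?lee_fin ?subr_ge0//.
exact: measure_superlevel_rearrangement.
Qed.

(** * Sampling the rearrangement at the points [2^i t] *)

Section dyadic_sampling.
Context d (T : measurableType d) (R : realType).
Variables (mu : {measure set T -> \bar R}) (f : T -> \bar R).
Hypothesis mf : measurable_fun setT f.
Local Notation fs := (rearrangement mu f).
Local Notation leb := (@lebesgue_measure R).

Let mfV (D : set (measurableTypeR R)) : D `<=` [set s | 0 < s] -> measurable D ->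
  measurable_fun D (fun s : measurableTypeR R => fs s * s^-1%:E)%E.
Proof.
move=> D0 mD; apply: emeasurable_funM; first exact: measurable_rearrangement.
(* The value [+oo] on [s <= 0] makes [1/s] nonincreasing on the whole line, which gives
   measurability. *)
apply: (@eq_measurable_fun _ _ _ _ D
    (fun s : measurableTypeR R => if 0 < s then s^-1%:E else +oo%E)).
  by move=> s; rewrite inE => /D0/= ->.
apply: measurable_funTS; apply: nonincreasing_emeasurable => a b ab.
have [a0|_] := ltP 0 a; last by rewrite leey.
have b0 := lt_le_trans a0 ab.
by rewrite b0 lee_fin lef_pV2.
Qed.

Lemma rearrangement_le_average t : 0 < t ->
  (fs t <= t^-1%:E * \int[leb]_(s in `]0%R, t]) fs s)%E.
Proof.
move=> t0.
have -> : (fs t = t^-1%:E * \int[leb]_(s in `]0%R, t]) fs t)%E.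
  rewrite integral_cst_itv ?ltW// subr0.
  by rewrite muleC -muleA -EFinM divff ?mule1// gt_eqF.
rewrite lee_wpmul2l ?lee_fin ?invr_ge0 ?(ltW t0)//.
apply: ge0_le_integral => //.
- by move=> *; exact: rearrangement_ge0.
- exact: measurable_rearrangement.
by move=> s/=; rewrite in_itv/= => /andP[_ st]; exact: le_rearrangement.
Qed.

(** On [[2^i t, 2^(i+1) t[] the integrand is at least [f^*(2^(i+1) t) / (2^(i+1) t)], and the
    interval has half the length [2^(i+1) t]; hence the factor 2. *)
Lemma rearrangement_sum_le_tail t N : 0 < t ->
  (\sum_(i < N) fs (2 ^+ i.+1 * t) <=
   2%:E * \int[leb]_(s in `[t, +oo[) (fs s * s^-1%:E))%E.
Proof.
move=> t0.
have p0 i : 0 < 2 ^+ i * t by rewrite mulr_gt0// exprn_gt0.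
apply: (@le_trans _ _ (2%:E *
    \int[leb]_(s in `[t, (2 ^+ N * t)%R[) (fs s * s^-1%:E))%E); last first.
  rewrite lee_wpmul2l ?lee_fin//; apply: ge0_subset_integral => //.
  - by apply: mfV => // s /=; rewrite in_itv/= andbT; exact: lt_le_trans.
  - move=> s /=; rewrite in_itv/= andbT => ts.
    by rewrite mule_ge0 ?rearrangement_ge0// lee_fin invr_ge0 (le_trans _ ts)// ltW.
  - by move=> s /=; rewrite !in_itv/= andbT => /andP[].
elim: N => [|N IH].
  by rewrite big_ord0 mule_ge0// ?lee_fin// expr0 mul1r set_itvco0 integral_set0.
rewrite big_ord_recr/=.
have tN : t <= 2 ^+ N * t by rewrite ler_peMl ?exprn_ege1 ?ler1n// ltW.
have NN : 2 ^+ N * t <= 2 ^+ N.+1 * t by rewrite ler_wpM2r ?ler_weXn2l ?ler1n// ltW.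
have -> : `[t, (2 ^+ N.+1 * t)%R[%classic =
    `[t, (2 ^+ N * t)%R[%classic `|` `[(2 ^+ N * t)%R, (2 ^+ N.+1 * t)%R[%classic.
  by apply: itv_bndbnd_setU; rewrite bnd_simp.
rewrite ge0_integral_setU//; last 3 first.
- apply: mfV; last exact: measurableU.
  move=> s /= [|]; rewrite in_itv/= => /andP[];
    first by move=> /(lt_le_trans t0).
  by move/(lt_le_trans (p0 N)).
- move=> s /= [|]; rewrite in_itv/= => /andP[ts _];
    rewrite mule_ge0 ?rearrangement_ge0// lee_fin invr_ge0 (le_trans _ ts)// ltW//.
- rewrite disj_set2E; apply/eqP; rewrite -subset0 => s /=; rewrite !in_itv/=.
  by case=> /andP[_ sN] /andP[/le_lt_trans/(_ sN)]; rewrite ltxx.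
rewrite ge0_muleDr; last 2 first.
- apply: integral_ge0 => s /=; rewrite in_itv/= => /andP[ts _].
  by rewrite mule_ge0 ?rearrangement_ge0// lee_fin invr_ge0 (le_trans _ ts)// ltW.
- apply: integral_ge0 => s /=; rewrite in_itv/= => /andP[ts _].
  by rewrite mule_ge0 ?rearrangement_ge0// lee_fin invr_ge0 (le_trans _ ts)// ltW.
rewrite leeD//.
have -> : fs (2 ^+ N.+1 * t) =
  (2%:E * \int[leb]_(s in `[(2 ^+ N * t)%R, (2 ^+ N.+1 * t)%R[)
    (fs (2 ^+ N.+1 * t) * (2 ^+ N.+1 * t)^-1%:E))%E.
  rewrite integral_cst_itv//.
  rewrite -muleA -EFinM muleCA -EFinM.
  rewrite [X in X%:E](_ : _ = 1) ?mule1//.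
  by rewrite exprS; field; rewrite !gt_eqF// exprn_gt0.
rewrite lee_wpmul2l ?lee_fin//.
apply: ge0_le_integral => //.
- by move=> s _; rewrite mule_ge0 ?rearrangement_ge0// lee_fin invr_ge0 ltW.
- by apply: mfV => // s /=; rewrite in_itv/= => /andP[/(lt_le_trans (p0 N))].
move=> s /=; rewrite in_itv/= => /andP[sN sN'].
have s0 := lt_le_trans (p0 N) sN.
apply: lee_pmul; rewrite ?rearrangement_ge0 ?lee_fin ?invr_ge0 ?(ltW (p0 _))//.
  by apply: le_rearrangement; exact: ltW.
by rewrite lef_pV2 ?posrE// ltW.
Qed.

End dyadic_sampling.

(** * Choice of the truncation levels and margins *)

(** A cube on which [|f|] averages more than [c i + h i] has mean excess over [c i] above [h i]. The
    integral bound thus becomes, through the weak type estimate, a bound [2^i (t/2)] on the union of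
    such cubes. *)
Lemma threshold_sequences d (T : measurableType d) (R : realType)
    (mu : {sigma_finite_measure set T -> \bar R}) (f : T -> \bar R)
    (mf : measurable_fun setT f) (t B : R) : 0 < t -> 0 < B ->
  (t^-1%:E * (\int[@lebesgue_measure R]_(s in `]0%R, t]) rearrangement mu f s) +
   \int[@lebesgue_measure R]_(s in `[t, +oo[) (rearrangement mu f s * s^-1%:E)
   <= B%:E)%E ->
  exists c h : nat -> R,
    [/\ forall i, 0 <= c i, forall i, 0 < h i,
        forall i, (\int[mu]_x excess f (c i) x <= (2 ^+ i * (t / 2) * h i)%:E)%E
      & forall N, \sum_(i < N) (c i + h i) <= 11 * B].
Proof.
move=> t0 B0; set A := integral _ _ _; set Z := integral _ _ _ => AZB.
have A0 : (0 <= A)%E by apply: integral_ge0 => s _; exact: rearrangement_ge0.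
have Z0 : (0 <= Z)%E.
  apply: integral_ge0 => s /=; rewrite in_itv/= andbT => ts.
  by rewrite mule_ge0 ?rearrangement_ge0// lee_fin invr_ge0 (le_trans _ ts)// ltW.
have AB : (t^-1%:E * A <= B%:E)%E by apply: le_trans AZB; rewrite leeDl.
have ZB : (Z <= B%:E)%E.
  by apply: le_trans AZB; rewrite leeDr// mule_ge0// lee_fin invr_ge0 ltW.
have AtB : (A <= (t * B)%:E)%E.
  rewrite EFinM (_ : A = t%:E * (t^-1%:E * A))%E; last first.
    by rewrite muleA -EFinM divff ?mul1e// gt_eqF.
  by rewrite lee_wpmul2l// lee_fin ltW.
pose F i := rearrangement mu f (2 ^+ i * t).
have FB i : (F i <= B%:E)%E.
  have fst := rearrangement_le_average mu f t0.
  apply: le_trans (le_trans fst AB).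
  by apply: le_rearrangement; rewrite ler_peMl ?exprn_ege1 ?ler1n// ltW.
have F0 i : (0 <= F i)%E by exact: rearrangement_ge0.
have Ffin i : F i \is a fin_num.
  by rewrite ge0_fin_numE// (le_lt_trans (FB i))// ltry.
pose c i := fine (F i).
have cE i : (c i)%:E = F i by rewrite /c fineK.
have c0 i : 0 <= c i by rewrite -lee_fin cE.
have cB i : c i <= B by rewrite -lee_fin cE.
have cS i : c i.+1 <= c i.
  rewrite -lee_fin !cE; apply: le_rearrangement.
  by rewrite ler_wpM2r ?ler_weXn2l ?ler1n// ltW.
(* Each recurrence step absorbs the increase in integral_excess_step, and
   2 * h i + 4 * c i drops by exactly h i. *)
pose h := fix h i := if i is j.+1 then h j / 2 + 2 * (c j - c j.+1) else 2 * B.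
have hS i : h i.+1 = h i / 2 + 2 * (c i - c i.+1) by [].
have h0 i : 0 < h i.
  elim: i => [|i IH]; first by rewrite /= mulr_gt0.
  by rewrite hS; have := cS i; lra.
exists c, h; split=> //.
- elim=> [|i IH].
    (* The start [h 0 = 2 B] comes from [A <= t B = (t/2) (2 B)]. *)
    rewrite expr0 mul1r;
      apply: le_trans (integral_excess_le mf (t := t) (c0 0%N) _) _.
      by rewrite cE /F expr0 mul1r.
    apply: (le_trans AtB); rewrite lee_fin /=; lra.
  have := integral_excess_step (mu := mu) mf (s := 2 ^+ i.+1 * t) (c0 i.+1) (cS i).
  rewrite cE => /(_ (lexx _)) /le_trans; apply.
  apply: (le_trans (leeD2r _ IH)); rewrite -EFinD lee_fin hS exprS; lra.
- move=> N; rewrite big_split/=.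
  (* Telescoping bounds the sum of the [h i] by [4 B + 4 c_0 <= 8 B]; the tail integral bounds that
     of the [c i] by [c_0 + 2 B <= 3 B]. Together they give 11 B. *)
  have hsum : \sum_(i < N) h i + 2 * h N + 4 * c N = 4 * B + 4 * c 0%N.
    elim: N => [|N IH]; first by rewrite big_ord0 /=; lra.
    by rewrite big_ord_recr/= -/(h N); lra.
  have csum : \sum_(i < N) c i.+1 <= 2 * B.
    rewrite -lee_fin -sumEFin; under eq_bigr do rewrite cE.
    apply: le_trans (rearrangement_sum_le_tail mu f N t0) _.
    by rewrite EFinM lee_wpmul2l ?lee_fin.
  have csum' : \sum_(i < N) c i <= c 0%N + \sum_(i < N) c i.+1.
    rewrite -(big_ord_recl N (fun i => c i))/=.
    by rewrite big_ord_recr/= lerDl.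
  have := cB 0%N; have := c0 N; have := h0 N; lra.
Qed.

(** * Summation over threshold classes *)

(** Each product [a Q * b Q] is charged to the last scale before [Q] crosses a threshold, and the
    weight of each class pays for it. An index that crosses none up to [N] is paid for by the bound
    on the total weight, whence the additional term [lam N]. *)
Lemma threshold_sum_le (R : realType) (I : eqType) (s : seq I) (a b w : I -> R)
    (lam : nat -> R) (X : R) (N : nat) :
  (forall i, 0 <= lam i) ->
  (forall Q, Q \in s ->
    [/\ 0 <= a Q, a Q <= lam 0%N, 0 <= b Q, b Q <= 1 & 0 <= w Q]) ->
  (forall i, \sum_(Q <- s | (lam i < a Q) || (2 ^- i < b Q)) w Q <= 2 ^+ i * X) ->
  \sum_(Q <- s) w Q <= 2 ^+ N * X ->
  \sum_(Q <- s) a Q * b Q * w Q <= 2 * X * \sum_(i < N.+1) lam i.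
Proof.
move=> lam0 abw wX wN.
pose P i Q := (lam i < a Q) || (2 ^- i < b Q).
have p0 i : 0 < 2 ^- i :> R by rewrite invr_gt0 exprn_gt0.
have p1 i : 2 ^- i * 2 ^+ i = 1 :> R by rewrite mulVf// gt_eqF// exprn_gt0.
(* Induction on [N]: either a crossing has already occurred, or both thresholds still hold at [N].
   The base case is [a Q <= lam 0] and [b Q <= 1]. *)
have split_ab Q : Q \in s ->
    a Q * b Q <= \sum_(i < N) lam i * 2 ^- i * (P i.+1 Q)%:R \/
    (a Q <= lam N /\ b Q <= 2 ^- N).
  move=> /abw[a0 al b0 b1 _]; elim: N {wN} => [|N [IH|[aN bN]]].
  - by right; rewrite expr0 invr1.
  - left; rewrite big_ord_recr/=; apply: (le_trans IH).
    by rewrite lerDl !mulr_ge0// ltW.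
  - case PN : (P N.+1 Q); [left|right].
      rewrite big_ord_recr/= PN mulr1.
      apply: (le_trans (ler_pM a0 b0 aN bN)); rewrite lerDr.
      by apply: sumr_ge0 => i _; rewrite !mulr_ge0// ltW.
    by move: PN; rewrite /P => /norP[]; rewrite -!leNgt.
apply: (@le_trans _ _ (\sum_(Q <- s) (\sum_(i < N) lam i * 2 ^- i * (P i.+1 Q)%:R
    + lam N * 2 ^- N) * w Q)).
  rewrite big_seq [leRHS]big_seq; apply: ler_sum => Q Qs.
  have [a0 _ b0 _ w0] := abw _ Qs; rewrite ler_wpM2r//.
  have [ab|[aN bN]] := split_ab _ Qs.
    by apply: (le_trans ab); rewrite lerDl mulr_ge0// ltW.
  apply: (le_trans (ler_pM a0 b0 aN bN)); rewrite lerDr.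
  by apply: sumr_ge0 => i _; rewrite !mulr_ge0// ltW.
have X0 : 0 <= X.
  have : 0 <= \sum_(Q <- s) w Q.
    by rewrite big_seq; apply: sumr_ge0 => Q /abw[].
  by move/le_trans => /(_ _ wN); rewrite pmulr_rge0// exprn_gt0.
under eq_bigr do rewrite mulrDl mulr_suml.
rewrite big_split/= exchange_big/= -mulr_sumr big_ord_recr/= mulrDr.
apply: lerD; last first.
  apply: (@le_trans _ _ (lam N * 2 ^- N * (2 ^+ N * X))).
    by rewrite ler_wpM2l// mulr_ge0// ltW.
  have -> : lam N * 2 ^- N * (2 ^+ N * X) = lam N * X * (2 ^- N * 2 ^+ N) by ring.
  by rewrite p1; have := mulr_ge0 (lam0 N) X0; lra.
rewrite mulr_sumr; apply: ler_sum => i _.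
under eq_bigr do rewrite -mulrA mulr_natl mulrb.
rewrite -mulr_sumr -big_mkcond/=.
apply: (@le_trans _ _ (lam i * 2 ^- i * (2 ^+ i.+1 * X))).
  (* The charge is made at scale [i] but the weight is that of the class [i + 1]; this shift costs
     the factor 2. *)
  by apply: ler_wpM2l (wX i.+1); rewrite mulr_ge0// ltW.
have -> : lam i * 2 ^- i * (2 ^+ i.+1 * X) = 2 * X * lam i * (2 ^- i * 2 ^+ i).
  by rewrite exprS; ring.
by rewrite p1 mulr1.
Qed.

(** * Weak type estimate for nested families *)

Definition nested (T : choiceType) (s : seq (set T)) :=
  {in s &, forall Q Q', [\/ Q `&` Q' = set0, Q `<=` Q' | Q' `<=` Q]}.

(** The maximal members are disjoint and cover the union, so the hypothesis adds up over them. The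
    induction is on a bound for the size, since removing all subsets of a maximal member may shorten
    the list by any amount. *)
Lemma nested_weak_type d (T : measurableType d) (R : realType)
    (mu : {measure set T -> \bar R}) (u : T -> \bar R) (l : R) (s : seq (set T)) :
  measurable_fun setT u -> (forall x, 0 <= u x)%E ->
  {in s, forall Q, measurable Q} -> nested s ->
  {in s, forall Q, l%:E * mu Q <= \int[mu]_(x in Q) u x}%E ->
  (l%:E * mu (\bigcup_(Q in [set` s]) Q)
     <= \int[mu]_(x in \bigcup_(Q in [set` s]) Q) u x)%E.
Proof.
move=> mu_u u0; have [n] := ubnP (size s); elim: n s => // n IH [_ _ _ _|Q s].
  by rewrite set_nil bigcup_set0 measure0 mule0 integral_set0.
rewrite /= ltnS => sn ms ns ls.
have sub s' : {subset s' <= Q :: s} -> (size s' < n)%N ->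
    (l%:E * mu (\bigcup_(Q in [set` s']) Q)
     <= \int[mu]_(x in \bigcup_(Q in [set` s']) Q) u x)%E.
  move=> s's s'n; apply: IH => // [Q' /s's|Q1 Q2 /s's ? /s's ?|Q' /s's].
  - exact: ms.
  - exact: ns.
  - exact: ls.
have [[Q' Q's QQ']|noQ] := pselect (exists2 Q', Q' \in s & Q `<=` Q').
  rewrite (_ : \bigcup_(_ in _) _ = \bigcup_(Q in [set` s]) Q).
    by apply: sub => // Q1 Q1s; rewrite inE Q1s orbT.
  apply/seteqP; split=> x [Q1 /=].
    by rewrite inE => /predU1P[->|Q1s] Q1x; [exists Q' => //;
      exact: QQ'|exists Q1].
  by move=> Q1s Q1x; exists Q1 => //=; rewrite inE Q1s orbT.
(* Here [Q] lies in no other member, so by nestedness whatever survives this filter is disjoint from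
   [Q]. *)
pose s1 := [seq Q' <- s | ~~ `[< Q' `<=` Q >]].
have s1s : {subset s1 <= Q :: s}.
  by move=> Q'; rewrite mem_filter inE => /andP[_ ->]; rewrite orbT.
have -> : \bigcup_(Q in [set` Q :: s]) Q = Q `|` \bigcup_(Q in [set` s1]) Q.
  apply/seteqP; split=> [x [Q1 /=]|x [Qx|[Q1 /= Q1s Q1x]]].
  - rewrite inE => /predU1P[->|Q1s] Q1x; first by left.
    have [Q1Q|Q1Q] := pselect (Q1 `<=` Q); first by left; exact: Q1Q.
    by right; exists Q1 => //=; rewrite mem_filter Q1s andbT; exact/asboolPn.
  - by exists Q => //=; rewrite mem_head.
  - by exists Q1 => //; exact: s1s.
have mQ : measurable Q by apply: ms; rewrite mem_head.
have mU : measurable (\bigcup_(Q in [set` s1]) Q).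
  by apply: fin_bigcup_measurable => [|Q1 /= /s1s];
    [exact: finite_seq|exact: ms].
have dQ : Q `&` \bigcup_(Q in [set` s1]) Q = set0.
  rewrite -subset0 => x [Qx [Q1 /= Q1s Q1x]].
  have := Q1s; rewrite mem_filter => /andP[/asboolPn nQ1Q Q1s'].
  have [QQ1|QQ1|//] := ns Q Q1 (mem_head _ _) (s1s _ Q1s).
    by have : set0 x by rewrite -QQ1.
  by apply: noQ; exists Q1.
rewrite measureU// ge0_integral_setU//; last 2 first.
- exact: measurable_funTS.
- by apply/disj_setPS; rewrite dQ.
rewrite muleDr ?ge0_adde_def ?inE ?measure_ge0//.
apply: leeD; first by apply: ls; rewrite mem_head.
apply: sub => //; apply: leq_ltn_trans sn.
by rewrite size_filter count_size.
Qed.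

Lemma sum_disjoint_parts_le d (T : measurableType d) (R : realType)
    (mu : {measure set T -> \bar R}) (E : set T -> set T) (s : seq (set T)) :
  uniq s -> {in s, forall Q, measurable Q} ->
  {in s, forall Q, measurable (E Q) /\ E Q `<=` Q} -> trivIset [set` s] E ->
  (\sum_(Q <- s) mu (E Q) <= mu (\bigcup_(Q in [set` s]) Q))%E.
Proof.
move=> us ms mE tE; rewrite fsbig_seq// -measure_fin_bigcup//; last first.
  by move=> Q /= /mE[].
apply: le_measure; rewrite ?inE.
- by apply: fin_bigcup_measurable => // Q /= /mE[].
- by apply: fin_bigcup_measurable => //; exact: finite_seq.
- by apply: subset_bigcup => Q /= /mE[].
Qed.

(** * Level set estimate for a finite sparse family *)

Section finite_sparse_family.
Context d (T : measurableType d) (R : realType).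
Variables (mu : {measure set T -> \bar R}) (f : T -> \bar R).
Variables (eta : R) (E : set T -> set T) (s : seq (set T)).
Hypothesis mf : measurable_fun setT f.
Hypothesis eta0 : 0 < eta.
Hypothesis us : uniq s.
Hypothesis ms : {in s, forall Q, measurable Q}.
Hypothesis ns : nested s.
Hypothesis s_gt0 : {in s, forall Q, (0 < mu Q)%E}.
Hypothesis s_lty : {in s, forall Q, (mu Q < +oo)%E}.
Hypothesis mE : {in s, forall Q, measurable (E Q) /\ E Q `<=` Q}.
Hypothesis etaE : {in s, forall Q, (eta%:E * mu Q <= mu (E Q))%E}.
Hypothesis tE : trivIset [set` s] E.

Let avg (Q : set T) : \bar R :=
  ((fine (mu Q))^-1%:E * \int[mu]_(x in Q) `|f x|)%E.

Let mabs D : measurable_fun D (fun x => `|f x|)%E.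
Proof. by apply: measurable_funTS; exact: measurableT_comp. Qed.

Let avg_ge0 Q : (0 <= avg Q)%E.
Proof.
by rewrite mule_ge0 ?integral_ge0// lee_fin invr_ge0 fine_ge0// measure_ge0.
Qed.

Let fin_mu : {in s, forall Q, mu Q \is a fin_num}.
Proof. by move=> Q Qs; rewrite ge0_fin_numE ?measure_ge0// s_lty. Qed.

Let fmu_gt0 : {in s, forall Q, 0 < fine (mu Q)}.
Proof. by move=> Q Qs; rewrite fine_gt0// s_gt0// s_lty. Qed.

Let mU (s' : seq (set T)) : {subset s' <= s} ->
  measurable (\bigcup_(Q in [set` s']) Q).
Proof.
move=> s's; apply: fin_bigcup_measurable => [|Q /= /s's];
  first exact: finite_seq.
exact: ms.
Qed.

Let nsub (s' : seq (set T)) : {subset s' <= s} -> nested s'.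
Proof. by move=> s's Q Q' /s's ? /s's ?; exact: ns. Qed.

(** Since [|f| <= excess f c + c], a selected set has mean excess above [h]; [nested_weak_type] then
    applies to the excess with constant [h]. *)
Lemma measure_bigcup_average_gt (c h K : R) : 0 <= c -> 0 < h ->
  (\int[mu]_x excess f c x <= (K * h)%:E)%E ->
  (mu (\bigcup_(Q in [set` [seq Q <- s | ((c + h)%:E < avg Q)%E]]) Q)
     <= K%:E)%E.
Proof.
move=> c0 h0 hK; set s' := seq.filter _ s.
have s's : {subset s' <= s} by move=> Q; rewrite mem_filter => /andP[].
have m_exc D : measurable_fun D (excess f c) by exact: measurable_excess.
have exc0 := excess_ge0 f c.
have : (h%:E * mu (\bigcup_(Q in [set` s']) Q) <= (K * h)%:E)%E.
  apply: (le_trans _ hK).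
  apply: (@le_trans _ _
    (\int[mu]_(x in \bigcup_(Q in [set` s']) Q) excess f c x)%E); last first.
    by apply: ge0_subset_integral => //; exact: mU.
  apply: nested_weak_type => //; [by move=> Q /s's; exact: ms|exact: nsub|].
  move=> Q Qs'; have Qs := s's _ Qs'.
  have mQ := ms Qs; have fQ := fin_mu Qs; have Q0 := fmu_gt0 Qs.
  rewrite leNgt; apply/negP => exc_lt.
  move: Qs'; rewrite mem_filter => /andP[+ _]; apply/negP; rewrite -leNgt /avg.
  rewrite lee_pdivrMl// -EFinM.
  apply: (@le_trans _ _ (\int[mu]_(x in Q) (excess f c x + c%:E)))%E.
    apply: ge0_le_integral => //; first exact: emeasurable_funD.
    by move=> x _; rewrite /excess -leeBlDr// le_max lexx.
  rewrite ge0_integralD// integral_cst//.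
  rewrite addeC mulrDr EFinD; apply: leeD.
    by rewrite mulrC EFinM fineK.
  by rewrite mulrC EFinM fineK// ltW.
by rewrite mulrC EFinM lee_pmul2l ?lte_fin.
Qed.

Lemma measure_bigcup_lty : (mu (\bigcup_(Q in [set` s]) Q) < +oo)%E.
Proof.
rewrite bigcup_seq; move: ms s_lty; elim: s => [|Q s' IH] ms' lty'.
  by rewrite big_nil measure0 ltry.
rewrite big_cons; have mQ : measurable Q by apply: ms'; rewrite mem_head.
have mU' : measurable (\big[setU/set0]_(Q <- s') Q).
  by rewrite big_seq; apply: bigsetU_measurable => Q' Q's; apply: ms';
    rewrite inE Q's orbT.
apply: le_lt_trans (measureU2 _ mQ mU') _.
rewrite lte_add_pinfty//; first by apply: lty'; rewrite mem_head.
by apply: IH => Q' Q's; [apply: ms'|apply: lty']; rewrite inE Q's orbT.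
Qed.

Let fin_E : {in s, forall Q, mu (E Q) \is a fin_num}.
Proof.
move=> Q Qs; have [mEQ EQ] := mE Qs.
rewrite ge0_fin_numE ?measure_ge0// (le_lt_trans _ (s_lty Qs))//.
by apply: le_measure; rewrite ?inE//; exact: ms.
Qed.

Let fin_bigcup (s' : seq (set T)) : {subset s' <= s} ->
  mu (\bigcup_(Q in [set` s']) Q) \is a fin_num.
Proof.
move=> s's; rewrite ge0_fin_numE ?measure_ge0// (le_lt_trans _ measure_bigcup_lty)//.
apply: le_measure; rewrite ?inE; [exact: mU|exact: mU|].
by apply: bigcup_subset => Q /= /s's.
Qed.

Let sum_parts_le (s' : seq (set T)) : {subset s' <= s} -> uniq s' ->
  \sum_(Q <- s') fine (mu (E Q)) <= fine (mu (\bigcup_(Q in [set` s']) Q)).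
Proof.
move=> s's us'.
rewrite -lee_fin -sumEFin fineK ?fin_bigcup//.
apply: le_trans (sum_disjoint_parts_le mu us' _ _ _).
- rewrite big_seq [leRHS]big_seq; apply: lee_sum => Q /s's Qs.
  by rewrite fineK// fin_E.
- by move=> Q /s's; exact: ms.
- by move=> Q /s's; exact: mE.
- by apply: sub_trivIset tE => Q /= /s's.
Qed.

(** This is [nested_weak_type] for the indicator of [F]. *)
Lemma measure_bigcup_density_gt (F : set T) (K : R) : measurable F -> 0 < K ->
  (K%:E * mu (\bigcup_(Q in
     [set` [seq Q <- s | (K%:E * mu Q < mu (F `&` Q))%E]]) Q) <= mu F)%E.
Proof.
move=> mF K0; set s' := seq.filter _ s.
have s's : {subset s' <= s} by move=> Q; rewrite mem_filter => /andP[].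
have m1 D : measurable_fun D (fun x => (\1_F x)%:E : \bar R).
  by apply/measurable_EFinP; exact: measurable_indic.
apply: (@le_trans _ _
  (\int[mu]_(x in \bigcup_(Q in [set` s']) Q) (\1_F x)%:E)%E); last first.
  rewrite integral_indic//; last exact: mU.
  by apply: le_measure; rewrite ?inE//; apply: measurableI => //; exact: mU.
apply: nested_weak_type => //; [by move=> Q /s's; exact: ms|exact: nsub|].
move=> Q Qs'; rewrite integral_indic//; last by apply: ms; exact: s's.
by move: Qs'; rewrite mem_filter => /andP[/ltW].
Qed.

Let measurable_avg_indic (Q : set T) D : measurable Q ->
  measurable_fun D (fun x => avg Q * (\1_Q x)%:E)%E.
Proof.
move=> mQ; apply: emeasurable_funM => //.
by apply/measurable_EFinP; exact: measurable_indic.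
Qed.

Lemma measurable_sparse_sum (s' : seq (set T)) D : {subset s' <= s} ->
  measurable_fun D (fun x => \sum_(Q <- s') avg Q * (\1_Q x)%:E)%E.
Proof.
elim: s' => [_|Q s' IH s's].
  by under eq_fun do rewrite big_nil; exact: measurable_cst.
under eq_fun do rewrite big_cons; apply: emeasurable_funD.
  by apply: measurable_avg_indic; apply: ms; apply: s's; rewrite mem_head.
by apply: IH => Q' Q's; apply: s's; rewrite inE Q's orbT.
Qed.

(** The estimates on [F] give at most 44 B / eta; the constant 45 makes the final contradiction
    strict. *)
Lemma measure_sparse_sum_gt (c h : nat -> R) (t B : R) : 0 < t -> 0 < B ->
  (forall i, 0 <= c i) -> (forall i, 0 < h i) ->
  (forall i, (\int[mu]_x excess f (c i) x <= (2 ^+ i * (t / 2) * h i)%:E)%E) ->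
  (forall N, \sum_(i < N) (c i + h i) <= 11 * B) ->
  (mu [set x | (45 * eta^-1 * B)%:E < \sum_(Q <- s) avg Q * (\1_Q x)%:E]
     <= t%:E)%E.
Proof.
move=> t0 B0 c0 h0 exc lamB.
set sigma := 45 * eta^-1 * B; set G := mkset _.
pose lam i := c i + h i.
have lam_gt0 i : 0 < lam i by rewrite ltr_wpDl.
have sigma0 : 0 < sigma by rewrite !mulr_gt0// invr_gt0.
have t10 (Q : set T) x : (0 <= avg Q * (\1_Q x)%:E)%E by rewrite mule_ge0// lee_fin.
have mG : measurable G.
  by rewrite -[X in measurable X]setTI; apply: emeasurable_fun_o_infty => //;
    exact: measurable_sparse_sum.
rewrite leNgt; apply/negP => tG.
pose Om := \bigcup_(Q in [set` [seq Q <- s | ((lam 0%N)%:E < avg Q)%E]]) Q.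
have mOm : measurable Om by apply: mU => Q; rewrite mem_filter => /andP[].
have Omt : (mu Om <= (t / 2)%:E)%E.
  have := measure_bigcup_average_gt (c0 0%N) (h0 0%N) (exc 0%N).
  by rewrite expr0 mul1r.
pose F := G `\` Om.
have mF : measurable F by exact: measurableD.
(* The sum vanishes off the cubes while [sigma > 0], so [F] has finite measure and real arithmetic
   is available. *)
have FU : F `<=` \bigcup_(Q in [set` s]) Q.
  move=> x [Gx _]; apply: contrapT => nx; move: Gx; rewrite /G/= big_seq big1.
    by rewrite lte_fin => /(lt_trans sigma0); rewrite ltxx.
  by move=> Q Qs; rewrite indicE memNset ?mule0// => Qx; apply: nx; exists Q.
have Flty : (mu F < +oo)%E.
  apply: le_lt_trans measure_bigcup_lty; apply: le_measure; rewrite ?inE//.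
  exact: mU.
have Ffin : mu F \is a fin_num by rewrite ge0_fin_numE.
pose phi := fine (mu F).
have phiE : phi%:E = mu F by rewrite fineK.
have phit : t / 2 < phi.
  have Om_fin : mu Om \is a fin_num.
    by rewrite ge0_fin_numE// (le_lt_trans Omt)// ltry.
  have : (t%:E < (phi + fine (mu Om))%:E)%E.
    apply: (lt_le_trans tG); rewrite EFinD phiE fineK//.
    apply: le_trans (measureU2 mu mF mOm).
    apply: le_measure; rewrite ?inE//; first exact: measurableU.
    by move=> x Gx; have [|] := pselect (Om x); [right|left].
  move: Omt; rewrite -[mu Om]fineK// lee_fin lte_fin; lra.
have phi0 : 0 < phi by apply: lt_trans phit; rewrite divr_gt0.
pose s' := [seq Q <- s | ~~ ((lam 0%N)%:E < avg Q)%E].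
have s's : {subset s' <= s} by move=> Q; rewrite mem_filter => /andP[].
have us' : uniq s' by rewrite filter_uniq.
have avg_le : {in s', forall Q, (avg Q <= (lam 0%N)%:E)%E}.
  by move=> Q; rewrite mem_filter -leNgt => /andP[].
have avg_fin : {in s', forall Q, avg Q \is a fin_num}.
  by move=> Q /avg_le Ql; rewrite ge0_fin_numE// (le_lt_trans Ql)// ltry.
have FQfin (Q : set T) : measurable Q -> mu (F `&` Q) \is a fin_num.
  move=> mQ; rewrite ge0_fin_numE// (le_lt_trans _ Flty)//.
  by apply: le_measure; rewrite ?inE//; exact: measurableI.
(* A point of [F] avoids [Om], so the sum there is carried by [s'] alone and still exceeds [sigma];
   integrate over [F]. *)
have dual : sigma * phi <= \sum_(Q <- s') fine (avg Q) * fine (mu (F `&` Q)).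
  rewrite -lee_fin EFinM phiE -sumEFin.
  rewrite -integral_cst//.
  apply: (@le_trans _ _ (\int[mu]_(x in F) \sum_(Q <- s') avg Q * (\1_Q x)%:E)%E).
    apply: ge0_le_integral => //; first by move=> *; rewrite lee_fin ltW.
      exact: measurable_sparse_sum.
    move=> x [Gx nOmx]; apply: (le_trans (ltW Gx)).
    rewrite big_filter [leRHS]big_mkcond big_seq [leRHS]big_seq;
      apply: lee_sum => Q Qs.
    case: ifPn => // /negPn lamQ; rewrite indicE memNset ?mule0// => Qx.
    by apply: nOmx; exists Q => //=; rewrite mem_filter lamQ.
  (* Termwise integration asks for measurability at every index, so the summand is set to zero
     outside [s']. *)
  pose g (Q : set T) x := if Q \in s' then (avg Q * (\1_Q x)%:E)%E else 0%E.
  rewrite (eq_integral (fun x => \sum_(Q <- s') g Q x)%E); last first.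
    by move=> x _; apply: eq_big_seq => Q Qs'; rewrite /g Qs'.
  rewrite ge0_integral_sum//; last 2 first.
  - move=> Q; rewrite /g; case: (boolP (Q \in s')) => Qs';
      last exact: measurable_cst.
    by apply: measurable_avg_indic; apply: ms; exact: s's.
  - by move=> Q x _; rewrite /g; case: ifP.
  rewrite big_seq [leRHS]big_seq; apply: lee_sum => Q Qs'.
  have mQ := ms (s's _ Qs').
  rewrite /g Qs' -[avg Q]fineK ?avg_fin//= ge0_integralZl_EFin//; last 2 first.
  - by apply/measurable_EFinP; exact: measurable_indic.
  - exact: fine_ge0.
  by rewrite integral_indic// setIC EFinM !fineK ?FQfin ?avg_fin.
pose al Q := fine (avg Q).
pose b (Q : set T) := fine (mu (F `&` Q)) / fine (mu Q).
pose w Q := fine (mu (E Q)).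
(* The total weight is finite, so some power of 2 dominates it; this is the cutoff for
   [threshold_sum_le]. *)
have [N NW] : exists N, \sum_(Q <- s') w Q <= 2 ^+ N * (2 * phi).
  exists (Num.truncn ((\sum_(Q <- s') w Q) / (2 * phi))).
  rewrite -ler_pdivrMr ?mulr_gt0//.
  apply: (le_trans (ltW (truncnS_gt _))).
  rewrite -natrX ler_nat; exact: ltn_expl.
have key : \sum_(Q <- s') al Q * b Q * w Q <= 2 * (2 * phi) * \sum_(i < N.+1) lam i.
  apply: threshold_sum_le => //.
  - by move=> i; exact: ltW.
  - move=> Q Qs'; have Qs := s's _ Qs'; have mQ := ms Qs; split.
    + exact: fine_ge0.
    + by rewrite -lee_fin /al fineK ?avg_le// avg_fin.
    + by rewrite divr_ge0// fine_ge0.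
    + rewrite ler_pdivrMr ?fmu_gt0// mul1r -lee_fin !fineK ?FQfin ?fin_mu//.
      by apply: le_measure; rewrite ?inE//; exact: measurableI.
    + exact: fine_ge0.
  - move=> i.
    (* The two conditions contribute at most [2^i (t/2)] and [2^i phi]; as [t/2 < phi], the class
       has weight at most [2^i X] with [X = 2 phi]. *)
    apply: (@le_trans _ _ (\sum_(Q <- s' | lam i < al Q) w Q +
                           \sum_(Q <- s' | 2 ^- i < b Q) w Q)).
      rewrite [leLHS]big_mkcond [X in _ <= X + _]big_mkcond.
      rewrite [X in _ <= _ + X]big_mkcond -big_split/=; apply: ler_sum => Q _.
      have w0 : 0 <= w Q by exact: fine_ge0.
      by case: (lam i < al Q); case: (2 ^- i < b Q) => /=; lra.
    have p2 : 0 < 2 ^+ i :> R by rewrite exprn_gt0.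
    apply: (@le_trans _ _ (2 ^+ i * (t / 2) + 2 ^+ i * phi)); last first.
      by rewrite -mulrDr ler_wpM2l ?ltW//; lra.
    apply: lerD; rewrite -big_filter.
      set s2 := seq.filter _ _.
      have s2s : {subset s2 <= s} by move=> Q;
        rewrite mem_filter => /andP[_ /s's].
      apply: (le_trans (sum_parts_le s2s (filter_uniq _ us'))).
      have H := measure_bigcup_average_gt (c0 i) (h0 i) (exc i).
      rewrite -lee_fin; apply: le_trans H.
      rewrite fineK ?fin_bigcup//.
      apply: le_measure; rewrite ?inE; first exact: mU.
        by apply: mU => Q; rewrite mem_filter => /andP[].
      apply: bigcup_subset => Q /=; rewrite mem_filter => /andP[lQ Qs'].
      by rewrite mem_filter s's// andbT -[avg Q]fineK ?lte_fin ?avg_fin.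
    set s2 := seq.filter _ _.
    have s2s : {subset s2 <= s} by move=> Q;
      rewrite mem_filter => /andP[_ /s's].
    apply: (le_trans (sum_parts_le s2s (filter_uniq _ us'))).
    rewrite -ler_pdivrMl//.
    have H := measure_bigcup_density_gt mF (K := 2 ^- i).
    rewrite -lee_fin EFinM phiE fineK ?fin_bigcup//; apply: le_trans (H _);
      rewrite ?invr_gt0//.
    rewrite lee_pmul2l ?lte_fin ?invr_gt0//.
    apply: le_measure; rewrite ?inE; first exact: mU.
      by apply: mU => Q; rewrite mem_filter => /andP[].
    apply: bigcup_subset => Q /=; rewrite mem_filter => /andP[lQ Qs'].
    have Qs := s's _ Qs'; have mQ := ms Qs.
    rewrite mem_filter Qs andbT -[mu Q]fineK ?fin_mu// -[mu (F `&` Q)]fineK ?FQfin//.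
    by rewrite -EFinM lte_fin -ltr_pdivlMr ?fmu_gt0.
have : sigma * phi <= eta^-1 * (2 * (2 * phi) * (11 * B)).
  apply: (le_trans dual).
  apply: (@le_trans _ _ (eta^-1 * \sum_(Q <- s') al Q * b Q * w Q)); last first.
    rewrite ler_pM2l ?invr_gt0//; apply: (le_trans key).
    by rewrite ler_pM2l ?mulr_gt0// lamB.
  rewrite mulr_sumr big_seq [leRHS]big_seq; apply: ler_sum => Q Qs'.
  have Qs := s's _ Qs'; have mQ := ms Qs.
  have wQ : eta * fine (mu Q) <= w Q.
    rewrite /w -lee_fin EFinM (fineK (fin_mu Qs)) (fineK (fin_E Qs));
      exact: etaE.
  have Q0 := fmu_gt0 Qs.
  (* Writing [|F n Q|] as [b Q |Q|] exposes [eta |Q|], which sparsity bounds by [w Q]. *)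
  have -> : al Q * fine (mu (F `&` Q)) = eta^-1 * (al Q * b Q * (eta * fine (mu Q))).
    by rewrite /b; field; rewrite !gt_eqF.
  rewrite ler_pM2l ?invr_gt0// ler_wpM2l// mulr_ge0 ?divr_ge0 ?fine_ge0//.
apply/negP; rewrite -ltNge.
have -> : sigma * phi = eta^-1 * (45 * phi * B) by rewrite /sigma; ring.
rewrite ltr_pM2l ?invr_gt0//; have := mulr_gt0 phi0 B0; lra.
Qed.

End finite_sparse_family.

(** * Cubes, countability of dyadic grids, monotonicity of the measure *)

Section cubes.
Context (R : realType) (n : nat).
Implicit Types (Q : set (Rn R n)) (D S : set (set (Rn R n))).

Lemma measurable_cube (r : R) Q : is_cube r Q -> measurable Q.
Proof.
move=> [r0 [a [lb [rb ->]]]].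
apply: sub_caratheodory; apply: sub_sigma_algebra.
by apply: (@measurable_box R n (fun i => [set` _])) => i; exact: measurable_itv.
Qed.

Lemma measure_cube (r : R) Q : is_cube r Q ->
  lebesgue_Rn Q = (r ^+ n)%:E.
Proof.
move=> [r0 [a [lb [rb ->]]]].
rewrite (@lebesgue_Rn_box R n (fun i =>
  [set` Interval (BSide (lb i) (a i)) (BSide (rb i) (a i + r))]))//.
rewrite (eq_bigr (fun=> r%:E));
  first by rewrite prodEFin big_const_ord iter_mulr_1.
move=> i _; rewrite lebesgue_measure_itv/= lte_fin ltrDl r0 -EFinD.
by congr EFin; lra.
Qed.

Lemma cube_rational_point (r : R) Q : is_cube r Q ->
  exists q : {ffun 'I_n -> rat}, Q [tuple ratr (q i) : R | i < n].
Proof.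
move=> [r0 [a [lb [rb ->]]]].
have aq i : exists q : rat, ratr q \in `](a i), (a i + r)[.
  by apply: rat_in_itvoo; rewrite ltrDl.
exists [ffun i => projT1 (cid (aq i))] => i /=.
rewrite /Defs.coord tnth_mktuple ffunE.
have := projT2 (cid (aq i)).
by apply: subitvP; rewrite subitvE !bnd_simp.
Qed.

(** A cube of the grid is determined by its scale and any rational point in it, by the uniqueness
    clause of [dyadic_grid]; such pairs are countable. *)
Lemma countable_dyadic_grid D : dyadic_grid D -> countable D.
Proof.
move=> [cubeD _ uniqD].
pose P Q (kq : int * {ffun 'I_n -> rat}) :=
  is_cube (2 ^ kq.1 : R) Q /\ Q [tuple ratr (kq.2 i) : R | i < n].
have exP Q : D Q -> exists kq, P Q kq.
  move=> DQ; have [k cQ] := cubeD Q DQ; have [q Qq] := cube_rational_point cQ.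
  by exists (k, q).
pose code Q :=
  if pselect (D Q) is left DQ then projT1 (cid (exP Q DQ)) else (0, [ffun=> 0]).
have codeP Q : D Q -> P Q (code Q).
  move=> DQ; rewrite /code; case: pselect => // DQ'; exact: projT2 (cid _).
apply/countable_injP; exists (pickle \o code) => Q Q';
  rewrite !inE => DQ DQ' /=.
move/(pcan_inj (@pickleK _)) => codeQ.
have [cQ Qq] := codeP _ DQ; have [cQ' Qq'] := codeP _ DQ'.
rewrite -codeQ in cQ' Qq'.
have [Q0 [_ U]] := uniqD (code Q).1 [tuple ratr ((code Q).2 i) : R | i < n].
by rewrite -(U Q (And3 DQ cQ Qq)) -(U Q' (And3 DQ' cQ' Qq')).
Qed.

(** [lebesgue_Rn] is given by an outer measure on all subsets. This lets a superlevel set of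
    [sparse_operator S f] be bounded without proving it measurable. *)
Lemma le_lebesgue_Rn (A B : set (Rn R n)) : A `<=` B ->
  (lebesgue_Rn A <= lebesgue_Rn B)%E.
Proof.
move=> AB; rewrite /lebesgue_Rn /completed_measure_extension.
exact: (@le_outer_measure _ _ (borel_lebesgue R n)^*%mu).
Qed.

End cubes.

(** * Passage from finite subfamilies to the sparse operator *)

(** The difference of the positive and negative sums is at most their total, which is the sum of the
    [|a i|]. *)
Lemma abs_signed_esum_le (R : realType) (I : choiceType) (S : set I)
    (a b : I -> \bar R) : (forall i, S i -> `|a i| <= b i)%E ->
  (`|signed_esum S a| <= \esum_(i in S) b i)%E.
Proof.
move=> ab; rewrite /signed_esum.
apply: (le_trans (lee_abs_sub _ _)).
rewrite !gee0_abs ?esum_ge0// -esumD//.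
apply: le_esum => i Si; apply: le_trans (ab i Si).
by rewrite -[leRHS]/((abse \o a) i) fune_abse.
Qed.

(** The level set estimate needs a finite positive [B], whereas the right-hand side may be zero or
    infinite. A finite [y = r] is approached by [r + e / C]. *)
Lemma le_mule_approx (R : realType) (x y : \bar R) (C : R) :
  0 < C -> (0 <= y)%E ->
  (forall B : R, 0 < B -> (y <= B%:E)%E -> (x <= (C * B)%:E)%E) ->
  (x <= C%:E * y)%E.
Proof.
move=> C0 y0 xB; case: y y0 xB => [r r0 xB||//];
  last by rewrite gt0_muley ?leey// lte_fin.
apply/lee_addgt0Pr => e e0.
have rB : 0 < r + e / C by rewrite ltr_wpDl ?divr_gt0.
apply: le_trans (xB _ rB _) _; first by rewrite lee_fin lerDl divr_ge0// ltW.
have -> : C * (r + e / C) = C * r + e by field; rewrite gt_eqF.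
by rewrite EFinD EFinM.
Qed.

(** Enumerating the countable [S] exhausts it by finite families whose level sets [G N] increase;
    the finite bound does not depend on [N], so continuity from below transfers it. *)
Lemma measure_sparse_operator_gt (R : realType) (n : nat) (eta : R)
    (D S : set (set (Rn R n))) (f : Rn R n -> \bar R) (t B : R) :
  0 < eta -> dyadic_grid D -> S `<=` D -> sparse eta S -> measurable_fun setT f ->
  0 < t -> 0 < B ->
  (t^-1%:E * (\int[@lebesgue_measure R]_(s in `]0%R, t])
                rearrangement (@lebesgue_Rn R n) f s) +
   \int[@lebesgue_measure R]_(s in `[t, +oo[)
      (rearrangement (@lebesgue_Rn R n) f s * s^-1%:E) <= B%:E)%E ->
  (lebesgue_Rn [set x | (45 * eta^-1 * B)%:E < `|sparse_operator S f x|]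
     <= t%:E)%E.
Proof.
move=> eta0 gridD SD [E [mE EQ etaE tE]] mf t0 B0 RHS_B.
pose mu : {sigma_finite_measure set (Rn R n) -> \bar R} := @lebesgue_Rn R n.
have [c [h [c0 h0 exc chB]]] := threshold_sequences (mu := mu) mf t0 B0 RHS_B.
have [cubeD nestedD _] := gridD.
have muQ Q : S Q -> (0 < mu Q < +oo)%E.
  move=> /SD/cubeD[k cQ];
    have -> : mu Q = ((2 ^ k) ^+ n)%:E by exact: measure_cube.
  by rewrite ltry lte_fin exprn_gt0//; case: cQ.
have mS Q : S Q -> measurable Q.
  by move=> /SD/cubeD[k cQ]; exact: measurable_cube cQ.
pose avg (Q : set (Rn R n)) :=
  ((fine (mu Q))^-1%:E * \int[mu]_(x in Q) `|f x|)%E.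
have avg0 Q x : (0 <= avg Q * (\1_Q x)%:E)%E.
  by rewrite !mule_ge0 ?integral_ge0 ?lee_fin ?invr_ge0 ?fine_ge0// measure_ge0.
have /countable_injP[rk rk_inj] : countable S.
  by apply: sub_countable (countable_dyadic_grid gridD); exact: subset_card_le.
pose SN N := S `&` [set Q | (rk Q < N)%N].
have finS N : finite_set (SN N).
  (* The default [N] keeps sets outside [S] out of the preimage of [I_N], so injectivity of [rk] on
     [S] suffices. *)
  pose rkN Q := if Q \in S then rk Q else N.
  apply: (@sub_finite_set _ _ (rkN @^-1` `I_N)).
    by move=> Q [SQ /= QN]; rewrite /rkN mem_set.
  apply: finite_preimage; last exact: finite_II.
  move=> Q Q'; rewrite !inE/= /rkN; case: ifPn => SQ; last by rewrite ltnn.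
  by case: ifPn => SQ'; [move=> _ _; exact: rk_inj|rewrite ltnn].
pose s N : seq (set (Rn R n)) := finmap.enum_fset (fset_set (SN N)).
have sP N Q : (Q \in s N) = (Q \in SN N) by rewrite in_fset_set.
have sS N Q : Q \in s N -> S Q by rewrite sP inE => -[].
pose G N :=
  [set x | ((45 * eta^-1 * B)%:E < \sum_(Q <- s N) avg Q * (\1_Q x)%:E)%E].
have Gt N : (mu (G N) <= t%:E)%E.
  apply: (@measure_sparse_sum_gt _ _ _ mu f eta E (s N)
    _ _ _ _ _ _ _ _ _ _ c h) => //.
  - exact: finmap.fset_uniq.
  - by move=> Q /sS; exact: mS.
  - by move=> Q Q' /sS/SD DQ /sS/SD DQ'; exact: nestedD.
  - by move=> Q /sS/muQ/andP[].
  - by move=> Q /sS/muQ/andP[].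
  - by move=> Q /sS SQ; split; [exact: mE|exact: EQ].
  - by move=> Q /sS; exact: etaE.
  - by apply: sub_trivIset tE => Q /= /sS.
have mG N : measurable (G N).
  rewrite -[X in measurable X]setTI; apply: emeasurable_fun_o_infty => //.
  by apply: (@measurable_sparse_sum _ _ _ mu f (s N)) => // Q /sS; exact: mS.
have GU : [set x | (45 * eta^-1 * B)%:E < `|sparse_operator S f x|]%E `<=`
    \bigcup_N G N.
  move=> x /= Tx.
  have : ((45 * eta^-1 * B)%:E < \esum_(Q in S) (avg Q * (\1_Q x)%:E))%E.
    apply: (lt_le_trans Tx); apply: abs_signed_esum_le => Q SQ.
    rewrite abseM [X in (_ * X <= _)%E]gee0_abs ?lee_fin//.
    rewrite lee_wpmul2r ?lee_fin// /average abseM gee0_abs; last first.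
      by rewrite lee_fin invr_ge0 fine_ge0// measure_ge0.
    rewrite lee_wpmul2l ?lee_fin ?invr_ge0 ?fine_ge0 ?measure_ge0//.
    by apply: le_abse_integral; [exact: mS|exact: measurable_funTS].
  (* The sum over [S] is a supremum over finite subsets, so some finite [A] already exceeds the
     level, and [A] lies in some [SN N]. *)
  move=> /ereal_sup_gt[_ [A [finA AS] <-]] CA.
  have [N AN] : exists N, A `<=` SN N.
    have /finite_seqP[l Al] := finA; exists (\max_(Q <- l) rk Q).+1 => Q AQ.
    split; first exact: AS.
    by rewrite /= ltnS; apply: leq_bigmax_seq => //; move: AQ; rewrite Al.
  exists N => //=; apply: (lt_le_trans CA).
  rewrite -fsbig_finite//; apply: lee_fsum_nneg_subset => //.
  by move=> Q; rewrite !inE; exact: AN.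
apply: le_trans (le_lebesgue_Rn GU) _.
have cG : mu (G N) @[N --> \oo] --> mu (\bigcup_N G N).
  apply: nondecreasing_cvg_mu => //; first exact: bigcup_measurable.
  apply/nondecreasing_seqP => N; apply/subsetPset => x /=.
  move/lt_le_trans; apply; rewrite -!fsbig_finite//.
  apply: lee_fsum_nneg_subset => // Q; rewrite !inE => -[SQ QN].
  by split=> //=; exact: ltnW.
rewrite -[lebesgue_Rn _]/(mu _) -(cvg_lim _ cG)//; apply: lime_le.
  by apply/cvg_ex; exists (mu (\bigcup_N G N)).
exact: nearW.
Qed.

Theorem corollary4p4 (R : realType) (n : nat) (n_gt0 : (0 < n)%N)
    (eta : R) (eta_gt0 : 0 < eta) (eta_lt1 : eta < 1)
    (D : set (set (Rn R n))) (gridD : dyadic_grid D)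
    (S : set (set (Rn R n))) (subSD : S `<=` D) (sparseS : sparse eta S) :
  exists C : R, 0 < C /\
    forall (t : R) (f : Rn R n -> \bar R),
      0 < t -> measurable_fun setT f ->
      (rearrangement (@lebesgue_Rn R n) (sparse_operator S f) t <=
       C%:E *
         (t^-1%:E * (\int[@lebesgue_measure R]_(s in `]0%R, t])
                       rearrangement (@lebesgue_Rn R n) f s) +
          \int[@lebesgue_measure R]_(s in `[t, +oo[)
             (rearrangement (@lebesgue_Rn R n) f s * s^-1%:E)))%E.
Proof.
exists (45 * eta^-1); split=> [|t f t0 mf]; first by rewrite mulr_gt0 ?invr_gt0.
apply: le_mule_approx; first by rewrite mulr_gt0 ?invr_gt0.
  rewrite adde_ge0 ?mule_ge0 ?integral_ge0 ?lee_fin ?invr_ge0 ?(ltW t0)//.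
    by move=> s _; exact: rearrangement_ge0.
  move=> s /=; rewrite in_itv/= andbT => ts.
  by rewrite mule_ge0 ?rearrangement_ge0// lee_fin invr_ge0 (le_trans _ ts)// ltW.
(* The level [45 B / eta] is admissible in the infimum defining the rearrangement at [t]. *)
move=> B B0 RHS_B; apply: ereal_inf_lbound; exists (45 * eta^-1 * B) => //.
split; first by rewrite !mulr_gt0 ?invr_gt0.
exact: (measure_sparse_operator_gt eta_gt0 gridD).
Qed.
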